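(* Let $n\ge 1$ and let $\Delta=(\Delta_{ij})$ be an integer $n\times n$ matrix such that $\det\Delta\neq 0$, $\Delta_{ij}\le 0$ for all $i\ne j$, and there exists a vector $\mathbf r\in\mathbb Z^n$ with $\mathbf r>0$ and $\mathbf r\Delta\ge 0$. Then $|\mathcal P(\Delta)|=|\mathcal R(\Delta)|=\det\Delta$.
   Context: Vectors are row vectors. $\mathbf r>0$ means $r_i>0$ for all $i$; $\mathbf r\ge \mathbf r'$ means $r_i\ge r'_i$ for all $i$. $\mathscr R(\Delta)=\{\mathbf r\in\mathbb Z^n : \mathbf r>0,\ \mathbf r\Delta\ge 0\}$. For $\mathbf r\in\mathscr R(\Delta)$, $\Omega(\mathbf r)$ is the set of integer vectors $\chi=(\chi(1),\dots,\chi(n))$ with $0\le\chi(i)\le r_i$ for every $i$ and $\chi(i)\ne 0$ for some $i$. $\Delta^j$ is the $j$-th column of $\Delta$, $\Delta_i$ is the $i$-th row of $\Delta$, and $\langle X,Y\rangle=\sum_{i=1}^n X_iY_i$. Parking functions: a $(\Delta,\mathbf r)$-parking function is a function $f:\{1,\dots,n\}\to\{0,1,2,\dots\}$ such that for every $\chi\in\Omega(\mathbf r)$ there exists $j$ with $\chi(j)\ge 1$ and $0\le f(j)<\langle\chi,\Delta^j\rangle$. The set $\mathcal P(\Delta,\mathbf r)$ of these is the same for all $\mathbf r\in\mathscr R(\Delta)$; the common set is denoted $\mathcal P(\Delta)$. Recurrent configurations: a configuration is a row vector $\mathbf u\in\mathbb Z^n$ with $u_i\ge 0$ for all $i$. A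 vertex $i\in\{1,\dots,n\}$ is critical for $\mathbf u$ if $u_i\ge\Delta_{ii}$; $\mathbf u$ is stable if no vertex is critical, i.e. $0\le u_i<\Delta_{ii}$ for all $i$. Toppling a critical vertex $i$ replaces $\mathbf u$ by $\mathbf u-\Delta_i$. A sequence of topplings from $\mathbf u$ is a sequence $i_1,\dots,i_k$ such that $i_j$ is critical for $\mathbf u-\Delta_{i_1}-\cdots-\Delta_{i_{j-1}}$ for each $1\le j\le k$; it transforms $\mathbf u$ into $\mathbf u-\sum_{j=1}^k\Delta_{i_j}$. A $(\Delta,\mathbf r)$-recurrent configuration is a stable configuration $\mathbf u$ such that $\mathbf u+\mathbf r\Delta$ can be transformed into $\mathbf u$ by a sequence of topplings. The set $\mathcal R(\Delta,\mathbf r)$ of these is the same for all $\mathbf r\in\mathscr R(\Delta)$; the common set is denoted $\mathcal R(\Delta)$. *)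

(* Defs.v *)
From HB Require Import structures.
From mathcomp Require Import all_boot all_order all_algebra.
From mathcomp Require Import finmap.
Set Implicit Arguments.
Unset Strict Implicit.
Unset Printing Implicit Defensive.
Import Order.TTheory GRing.Theory Num.Theory.
Local Open Scope ring_scope.

Section Chips.
Variables (n : nat) (Delta : 'M[int]_n).
Implicit Types (r chi u v : 'rV[int]_n) (i j : 'I_n) (s : seq 'I_n).

Definition rset r : Prop :=
  (forall i, 0 < r 0 i) /\ (forall i, 0 <= (r *m Delta) 0 i).

Definition Omega r chi : Prop :=
  (forall i, 0 <= chi 0 i <= r 0 i) /\ (exists i, chi 0 i != 0).

(* The sum is the pairing of chi with the j-th column of Delta; 0 <= f j is
   automatic since f takes its values in nat. *)
Definition is_parking r (f : {ffun 'I_n -> nat}) : Prop :=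
  forall chi, Omega r chi ->
    exists j, 1 <= chi 0 j /\ (f j)%:Z < \sum_i chi 0 i * Delta i j.

Definition configuration u : Prop := forall i, 0 <= u 0 i.

Definition critical u i : bool := Delta i i <= u 0 i.

Definition stable u : Prop := configuration u /\ forall i, ~~ critical u i.

Definition topple u i : 'rV[int]_n := u - row i Delta.

Fixpoint toppling_sequence u s : bool :=
  if s is i :: s' then critical u i && toppling_sequence (topple u i) s'
  else true.

Definition transforms u v : Prop :=
  exists s, toppling_sequence u s /\ foldl topple u s = v.

Definition is_recurrent r u : Prop :=
  stable u /\ transforms (u + r *m Delta) u.

End Chips.

(* Main.v *)
Require Import Defs.
From HB Require Import structures.
From mathcomp Require Import all_boot all_order all_algebra.
From mathcomp Require Import finmap.
From Stdlib Require Import Classical_Prop.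
From mathcomp Require Import ring lra zify.
Set Implicit Arguments.
Unset Strict Implicit.
Unset Printing Implicit Defensive.
Import Order.TTheory GRing.Theory Num.Theory.
Local Open Scope ring_scope.

(** Call [v >= 0] superstable when no nonzero [chi >= 0] satisfies
    [chi Delta <= v]. Parking functions are the superstable vectors, whichever
    [r] is used, and [u |-> (Delta_ii - 1 - u_i)_i] exchanges recurrent and
    superstable vectors: a legal toppling sequence from [u + r Delta] to [u]
    topples each [i] exactly [r_i] times, since [Delta] is injective. Each coset
    of the lattice [Z^n Delta] contains exactly one superstable vector. For
    uniqueness, if two of them differ by [w Delta] with [w <> 0], the positive
    part of [w] or of [-w] contradicts superstability. For existence,
    subtracting some [chi Delta] strictly decreases the pairing with the column
    [h = adj(Delta) 1], where [h >= 0] and [Delta h = det Delta 1]. By the Smith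
    normal form there are [|det Delta|] cosets, and [det Delta > 0] follows
    from an induction on Schur complements. *)

(** * Z-matrices and their Schur complements *)

Section ZMatrix.
Variable R : realDomainType.

Definition zmatrix n (A : 'M[R]_n) := forall i j, i != j -> A i j <= 0.

Lemma zmatrix_mul_le n (A : 'M[R]_n) (x y : 'rV_n) j : zmatrix A ->
  (forall i, y 0 i <= x 0 i) -> x 0 j = y 0 j -> (x *m A) 0 j <= (y *m A) 0 j.
Proof.
move=> zA yx xyj; rewrite !mxE; apply: ler_sum => i _.
have [->|ij] := eqVneq i j; first by rewrite xyj.
by rewrite ler_wnM2r ?zA.
Qed.

Lemma zmatrix_mul_le0 n (A : 'M[R]_n) (x : 'rV_n) j : zmatrix A ->
  (forall i, 0 <= x 0 i) -> x 0 j = 0 -> (x *m A) 0 j <= 0.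
Proof.
move=> zA x0 xj; rewrite -[leRHS](_ : ((0 : 'rV_n) *m A) 0 j = 0).
  by apply: zmatrix_mul_le => // [i|]; rewrite mxE.
by rewrite mul0mx mxE.
Qed.

(* The Schur complement of the top left entry, multiplied by that entry to stay
   division-free. *)
Definition schur n (A : 'M[R]_(1 + n)) : 'M_n :=
  A 0 0 *: drsubmx A - dlsubmx A *m ursubmx A.

(** Left multiplication by the block matrix with rows [1, 0] and [- dlsubmx A, (A 0 0)%:M], of
    determinant [A 0 0 ^+ n], clears the first column below the corner. *)
Lemma det_schur n (A : 'M[R]_(1 + n)) :
  A 0 0 ^+ n * \det A = A 0 0 * \det (schur A).
Proof.
have := det_mulmx (block_mx 1 0 (- dlsubmx A) (A 0 0)%:M) A.
have A00 : ulsubmx A = (A 0 0)%:M.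
  by rewrite [LHS]mx11_scalar !mxE; congr (A _ _)%:M; apply/val_inj.
rewrite -[X in _ *m X]submxK mulmx_block det_lblock det1 mul1r det_scalar => <-.
rewrite !mul1mx !mul0mx !addr0 A00 !mul_scalar_mx !mul_mx_scalar scalerN addNr.
by rewrite det_ublock det_scalar expr1 mulNmx [- _ + _]addrC.
Qed.

(** The coordinate [x 0 0] cancels on the right, so sign conditions on [x *m A] pass to the tail of
    [x] and [schur A]. *)
Lemma mul_schur n (A : 'M[R]_(1 + n)) (x : 'rV_(1 + n)) j :
  (rsubmx x *m schur A) 0 j =
    A 0 0 * (x *m A) 0 (rshift 1 j) - (x *m A) 0 0 * A 0 (rshift 1 j).
Proof.
have lshift0 : lshift n 0 = 0 :> 'I_(1 + n) by apply/val_inj.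
rewrite mxE (eq_bigr (fun i => A 0 0 * (x 0 (rshift 1 i) *
    A (rshift 1 i) (rshift 1 j)) - x 0 (rshift 1 i) * A (rshift 1 i) 0 *
    A 0 (rshift 1 j))); last first.
  by move=> i _; rewrite !mxE big_ord1 !mxE lshift0; ring.
rewrite sumrB -mulr_sumr -mulr_suml.
rewrite [(x *m A) 0 (rshift 1 j)]mxE [(x *m A) 0 0]mxE !big_split_ord /=.
by rewrite !big_ord1 lshift0; ring.
Qed.

(** Elimination preserves the sign pattern, the positive weight [r] and nonsingularity, so the
    induction hypothesis applies to [schur A]. *)
Lemma zmatrix_nonsing_monotone n (A : 'M[R]_n) (r : 'rV_n) : zmatrix A ->
    (forall i, 0 < r 0 i) -> (forall j, 0 <= (r *m A) 0 j) -> \det A != 0 ->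
  0 < \det A /\
  (forall w : 'rV_n, (forall i, 0 <= w 0 i) -> (forall j, (w *m A) 0 j <= 0) ->
    w = 0).
Proof.
elim: n A r => [|n IHn] A r zA r0 rA0 detA.
  by rewrite det_mx00; split=> // w _ _; apply/rowP => -[].
move: A r zA r0 rA0 detA; rewrite -[n.+1]/(1 + n)%N => A r zA r0 rA0 detA.
have lshift0 : lshift n 0 = 0 :> 'I_(1 + n) by apply/val_inj.
have zA0 i : A (rshift 1 i) 0 <= 0 by apply: zA; rewrite -val_eqE.
have zA1 i : A 0 (rshift 1 i) <= 0 by apply: zA; rewrite -val_eqE.
have mulA0 (x : 'rV_(1 + n)) : (x *m A) 0 0 =
    x 0 0 * A 0 0 + \sum_i x 0 (rshift 1 i) * A (rshift 1 i) 0.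
  by rewrite mxE big_split_ord big_ord1 /= lshift0.
have sum0 (x : 'rV_(1 + n)) : (forall i, 0 <= x 0 i) ->
    \sum_i x 0 (rshift 1 i) * A (rshift 1 i) 0 <= 0.
  by move=> x0; apply: sumr_le0 => i _; rewrite mulr_ge0_le0.
have r_ge0 i : 0 <= r 0 i by exact: ltW.
have A00 : 0 < A 0 0.
  rewrite lt_def -(pmulr_rge0 _ (r0 0)) andbC.
  have := rA0 0; rewrite mulA0 => rA0'; apply/andP; split.
    by have := sum0 _ r_ge0; lra.
  (* With a zero corner, [r *m A >= 0] at column 0 forces its nonpositive terms to vanish, and the
     whole column is zero. *)
  apply: contraNneq detA => A00; apply/eqP.
  have col0 i : A i 0 = 0.
    move: rA0'; rewrite A00 mulr0 add0r => rA0'.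
    case: (split_ordP i) => k ->; first by rewrite (ord1 k) lshift0.
    have sr0 : \sum_i - (r 0 (rshift 1 i) * A (rshift 1 i) 0) = 0.
      by rewrite sumrN; have := sum0 _ r_ge0; lra.
    have rA_ge0 j : 0 <= - (r 0 (rshift 1 j) * A (rshift 1 j) 0).
      by rewrite oppr_ge0 mulr_ge0_le0.
    move/eqP: (psumr_eq0P (fun j _ => rA_ge0 j) sr0 (i := k) isT).
    by rewrite oppr_eq0 mulf_eq0 gt_eqF ?r0 //= => /eqP.
  by rewrite (expand_det_col _ 0) big1 // => i _; rewrite col0 mul0r.
have det_schurA := det_schur A.
have zS : zmatrix (schur A).
  move=> i j ij; rewrite !mxE big_ord1 !mxE lshift0.
  have Aij : A (rshift 1 i) (rshift 1 j) <= 0.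
    by apply: zA; rewrite (inj_eq (@rshift_inj _ _)).
  by have := zA0 i; have := zA1 j; nra.
have [|||detS wS] := IHn (schur A) (rsubmx r) zS.
- by move=> i; rewrite mxE.
- move=> j; rewrite mul_schur subr_ge0 (@le_trans _ _ 0) //.
    by rewrite mulr_ge0_le0.
  by rewrite mulr_ge0 // ltW.
- have : A 0 0 ^+ n * \det A != 0 by rewrite mulf_neq0 ?expf_neq0 ?(gt_eqF A00).
  by rewrite det_schurA mulf_eq0 negb_or => /andP[].
split.
  by rewrite -(pmulr_rgt0 _ (exprn_gt0 n A00)) det_schurA mulr_gt0.
move=> w w0 wA.
have w'0 : rsubmx w = 0.
  apply: wS => [i|j]; first by rewrite mxE.
  rewrite mul_schur subr_le0 (@le_trans _ _ 0) //.
    by rewrite mulr_ge0_le0 // ltW.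
  by rewrite mulr_le0.
have w'i i : w 0 (rshift 1 i) = 0.
  by move/rowP: w'0 => /(_ i); rewrite !mxE.
apply/rowP => i; rewrite mxE; case: (split_ordP i) => k -> //.
rewrite (ord1 k) lshift0; apply/le_anti; rewrite w0 andbT.
rewrite -(pmulr_lle0 _ A00); have := wA 0; rewrite mulA0 big1 ?addr0 //.
by move=> j _; rewrite w'i mul0r.
Qed.
End ZMatrix.

(** * Cosets of the row lattice of a nonsingular matrix *)

Lemma coset_transversal n (A : 'M[int]_n) : \det A != 0 ->
  exists (T : finType) (rep : T -> 'rV[int]_n),
    [/\ #|T| = `|\det A|%N, forall x : 'rV_n, exists t w, x = rep t + w *m A
      & forall t t' w, rep t = rep t' + w *m A -> t = t'].
Proof.
move=> detA.
have [L uL [S uS [d _]]] := int_Smith_normal_form A.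
set D := (X in L *m X); move=> defA.
have absdet1 (M : 'M[int]_n) : M \in unitmx -> `|\det M|%N = 1%N.
  move=> uM; have := congr1 (absz \o determinant) (mulmxV uM).
  by rewrite /= det_mulmx det1 abszM => /eqP; rewrite muln_eq1 => /andP[/eqP].
have defD : D = diag_mx (\row_i d`_i).
  by apply/matrixP=> i j; rewrite !mxE.
have absdetA : `|\det A|%N = (\prod_(i < n) `|(d`_i)%R|)%N.
  rewrite defA !det_mulmx !abszM (absdet1 _ uL) (absdet1 _ uS) mul1n muln1.
  rewrite defD det_diag.
  rewrite (big_morph absz abszM (erefl _)).
  by apply: eq_bigr => i _; rewrite mxE.
have d0 i : (i < n)%N -> d`_i != 0.
  move=> ltin; rewrite -absz_gt0; apply: contraNT detA; rewrite -eqn0Ngt => di.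
  by rewrite -absz_eq0 absdetA (bigD1 (Ordinal ltin)) //= (eqP di).
have mulD (x : 'rV_n) j : (x *m D) 0 j = x 0 j * d`_j.
  by rewrite defD mul_mx_diag !mxE.
(* Since [A = L *m D *m S] with [L] invertible, the row lattice of [A] is that of [D] times [S]:
   residues modulo the [d_i], multiplied by [S], represent its cosets. *)
exists {dffun forall i : 'I_n, 'I_`|d`_i|}.
exists (fun t : {dffun forall i : 'I_n, 'I_`|d`_i|} =>
  (\row_i (t i)%:Z) *m S); split.
- rewrite card_dep_ffun absdetA foldrE big_image /=.
  by apply: eq_bigr => i _; rewrite card_ord.
- move=> x; pose y := x *m invmx S.
  have lt_mod (i : 'I_n) : (`|(modz (y 0 i) d`_i)%R| < `|(d`_i)%R|)%N.
    by rewrite -ltz_nat gez0_abs ?modz_ge0 ?d0 // ltz_mod ?d0.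
  exists [ffun i => Ordinal (lt_mod i)],
    ((\row_i divz (y 0 i) d`_i) *m invmx L).
  rewrite defA !mulmxA mulmxKV // -mulmxDl -[LHS](mulmxKV uS); congr (_ *m S).
  apply/rowP => i; rewrite -/y [RHS]mxE mulD ![(\row__ _) _ _]mxE ffunE /=.
  rewrite gez0_abs ?modz_ge0 ?d0 //.
  by rewrite addrC -divz_eq.
- move=> t t' w; rewrite defA !mulmxA -mulmxDl => /(can_inj (mulmxK uS)).
  move/rowP => tt'; apply/ffunP => i; apply/val_inj/eqP => /=.
  move: (tt' i); rewrite [RHS]mxE mulD !mxE => /(congr1 (modz^~ d`_i)).
  rewrite addrC modzMDl -!(modz_abs _ d`_i) !modz_small ?lez_nat ?ltz_nat //=.
  by case=> ->.
Qed.

(** This is the decrease of the measure in inductions on a coordinate sum. *)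
Lemma ltn_absz_sum (I : finType) (x y : I -> int) i :
  (forall j, 0 <= x j <= y j) -> x i < y i ->
  (`|(\sum_j x j)%R| < `|(\sum_j y j)%R|)%N.
Proof.
move=> xy xyi; rewrite -ltz_nat !gez0_abs ?sumr_ge0 //.
- rewrite (bigD1 i) // [ltRHS](bigD1 i) //= ltr_leD // ler_sum // => j _.
  by have /andP[] := xy j.
- by move=> j _; have /andP[/le_trans] := xy j; apply.
- by move=> j _; have /andP[] := xy j.
Qed.

(** * Superstable vectors, parking functions and recurrent configurations *)

Section Superstable.
Variables (n : nat) (Delta : 'M[int]_n).
Hypothesis zDelta : zmatrix Delta.
Implicit Types (r v w x chi u : 'rV[int]_n) (s : seq 'I_n).

Definition superstable v :=
  (forall i, 0 <= v 0 i) /\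
  (forall chi, (forall i, 0 <= chi 0 i) ->
     (forall j, (chi *m Delta) 0 j <= v 0 j) -> chi = 0).

Definition pospart x : 'rV[int]_n := \row_i Num.max (x 0 i) 0.

Lemma pospart_ge0 x i : 0 <= pospart x 0 i.
Proof. by rewrite mxE le_max lexx orbT. Qed.

Lemma pospart_eq0 x : pospart x = 0 -> forall i, x 0 i <= 0.
Proof. by move/rowP => x0 i; move: (x0 i); rewrite !mxE => /max_idPr. Qed.

(** Where [x 0 j >= 0], only coordinates other than [j] grow, and they meet nonpositive entries;
    where [x 0 j < 0], the positive part vanishes at [j], so its image there is at most [0]. *)
Lemma mul_pospart_le v x : (forall i, 0 <= v 0 i) ->
    (forall j, (x *m Delta) 0 j <= v 0 j) ->
  forall j, (pospart x *m Delta) 0 j <= v 0 j.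
Proof.
move=> v0 xv j; have [xj|xj] := leP 0 (x 0 j).
  apply: le_trans (xv j); apply: zmatrix_mul_le => // [i|].
    by rewrite mxE le_max lexx.
  by rewrite mxE; apply/max_idPl.
apply: le_trans (v0 j); apply: zmatrix_mul_le0 => // [i|].
  exact: pospart_ge0.
by rewrite mxE; apply/max_idPr/ltW.
Qed.

Lemma superstable_coset_inj v v' w : superstable v -> superstable v' ->
  v = v' + w *m Delta -> v = v'.
Proof.
move=> [v0 sv] [v'0 sv'] vv'.
have E j : v 0 j = v' 0 j + (w *m Delta) 0 j by rewrite vv' mxE.
suff w0 : w = 0 by rewrite vv' w0 mul0mx addr0.
have /pospart_eq0 w_le0 : pospart w = 0.
  apply: sv; [exact: pospart_ge0|apply: mul_pospart_le => // j].
  by rewrite E lerDr.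
have /pospart_eq0 w_ge0 : pospart (- w) = 0.
  apply: sv'; [exact: pospart_ge0|apply: mul_pospart_le => // j].
  by rewrite mulNmx mxE -subr_ge0 opprK -E.
apply/rowP => i; rewrite mxE; apply/le_anti; rewrite w_le0 /=.
by have := w_ge0 i; rewrite mxE oppr_le0.
Qed.

(** Stated for integer rows so that it also applies to [complement u]. *)
Definition parking_row r v := forall chi, Omega r chi ->
  exists j, 1 <= chi 0 j /\ v 0 j < (chi *m Delta) 0 j.

(* If chi violates superstability then so does the positive part of chi - r;
   iterating, one ends with a violation bounded by r. *)
Lemma parking_rowP r v : rset Delta r -> (forall i, 0 <= v 0 i) ->
  parking_row r v <-> superstable v.
Proof.
move=> [r0 rD0] v0; split=> [pv|[_ sv] chi [chi0r [i chi_i]]].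
  split=> // chi; have [k] := ubnP `|(\sum_i chi 0 i)%R|%N.
  elim: k chi => // k IHk chi lek chi0 chiv.
  have [//|chi_neq0] := eqVneq chi 0.
  have [i chi_i] : exists i, chi 0 i != 0 by apply/rV0Pn.
  have chi_r i' : (chi - r) 0 i' = chi 0 i' - r 0 i' by rewrite !mxE.
  have /pospart_eq0 chi_le_r : pospart (chi - r) = 0.
    apply: IHk; [|exact: pospart_ge0|apply: mul_pospart_le => // j].
      rewrite -ltnS (leq_trans _ lek) // ltnS.
      apply: (@ltn_absz_sum _ _ _ i) => [j|].
        by rewrite pospart_ge0 mxE chi_r ge_max chi0 andbT gerBl ltW.
      by rewrite mxE chi_r; have := r0 i; have := chi0 i; move: chi_i; lia.
    rewrite mulmxBl mxE [X in _ + X]mxE lerBlDr (le_trans (chiv j)) //.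
    by rewrite lerDl.
  have [|j [chij]] := pv chi; last by rewrite ltNge chiv.
  split; last by exists i.
  by move=> j; rewrite chi0 -subr_le0 -chi_r chi_le_r.
have [/existsP[j vj]|/existsPn nv] :=
    boolP [exists j, v 0 j < (chi *m Delta) 0 j].
  (* If [chi] vanished at [j], then [chi *m Delta] would be nonpositive there, hence not above
     [v]. *)
  exists j; split=> //; have [chi_j0|] := eqVneq (chi 0 j) 0; last first.
    by have /andP[] := chi0r j; lia.
  move: vj; rewrite ltNge (le_trans (zmatrix_mul_le0 _ _ chi_j0)) //.
  by move=> k; have /andP[] := chi0r k.
suff chi0 : chi = 0 by rewrite chi0 mxE eqxx in chi_i.
by apply: sv => j; [have /andP[] := chi0r j | rewrite leNgt nv].
Qed.

Lemma is_parkingP r (f : {ffun 'I_n -> nat}) : rset Delta r ->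
  is_parking Delta r f <-> superstable (\row_i (f i)%:Z).
Proof.
move=> Rr; rewrite -(parking_rowP Rr) => [|i]; last by rewrite mxE.
by split=> pf chi /pf[j]; rewrite ?mxE => -[? ?]; exists j; rewrite ?mxE.
Qed.

(** Otherwise the unit vector ['e_i] would violate superstability. *)
Lemma superstable_lt_diag v i : superstable v -> v 0 i < Delta i i.
Proof.
move=> [v0 sv]; rewrite ltNge; apply/negP => Dv.
have := sv 'e_i; rewrite -rowE => /(_ _ _)/rowP/(_ i).
rewrite !mxE !eqxx => H; suff: 1 = 0 :> int by [].
apply: H => j; first by rewrite mxE; case: (_ && _).
rewrite mxE; have [<-//|ij] := eqVneq i j.
exact: le_trans (zDelta ij) (v0 j).
Qed.

Definition toppling_count s : 'rV[int]_n := \row_i (count_mem i s)%:Z.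

Lemma toppling_count_cons i s :
  toppling_count (i :: s) = 'e_i + toppling_count s.
Proof. by apply/rowP => j; rewrite !mxE /= PoszD eq_sym natz. Qed.

Lemma foldl_topple u s :
  foldl (topple Delta) u s = u - toppling_count s *m Delta.
Proof.
elim: s u => [|i s IHs] u /=.
  rewrite (_ : toppling_count [::] = 0) ?mul0mx ?subr0 //.
  by apply/rowP => i; rewrite !mxE.
by rewrite IHs toppling_count_cons mulmxDl -rowE opprD addrA.
Qed.

(** The [- 1] turns the weak inequality of [critical] into the strict one of the parking
    condition. *)
Definition complement u : 'rV[int]_n := \row_i (Delta i i - 1 - u 0 i).

Lemma complementK : involutive complement.
Proof. by move=> u; apply/rowP => i; rewrite !mxE; ring. Qed.

Lemma criticalE u x i :
  critical Delta (u + x) i = (complement u 0 i < x 0 i).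
Proof. by rewrite /critical !mxE addrAC ltrBlDr ltzD1 lerBlDl. Qed.

(** The parking condition at [chi] provides a critical vertex [j] of [u + chi *m Delta] with
    [chi 0 j >= 1]; topple it and continue with [chi - 'e_j]. *)
Lemma parking_row_toppling r u chi : parking_row r (complement u) ->
    (forall i, 0 <= chi 0 i <= r 0 i) ->
  exists s, toppling_sequence Delta (u + chi *m Delta) s /\
    foldl (topple Delta) (u + chi *m Delta) s = u.
Proof.
move=> pu; have [k] := ubnP `|(\sum_i chi 0 i)%R|%N.
elim: k chi => // k IHk chi lek chi0r.
have [->|chi_neq0] := eqVneq chi 0.
  by exists [::]; rewrite mul0mx addr0.
have [|j [chij uj]] := pu chi.
  by split=> //; apply/rV0Pn.
have topE : topple Delta (u + chi *m Delta) j = u + (chi - 'e_j) *m Delta.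
  by rewrite /topple mulmxBl -rowE addrA.
have [||s [ts us]] := IHk (chi - 'e_j).
- rewrite -ltnS (leq_trans _ lek) // ltnS (@ltn_absz_sum _ _ _ j) // => [i|].
    rewrite !mxE eqxx /=; have /andP[] := chi0r i.
    by case: eqVneq => [->|_] /=; move: chij; lia.
  by rewrite !mxE !eqxx /=; lia.
- move=> i; rewrite !mxE eqxx /=; have /andP[] := chi0r i.
  by case: eqVneq => [->|_] /=; move: chij; lia.
by exists (j :: s); rewrite /= topE criticalE uj.
Qed.

(* Given chi <= toppling_count s, the witness j is the vertex whose toppling
   first makes the remaining count fail to dominate chi. *)
Lemma toppling_parking_row u s chi :
    toppling_sequence Delta (u + toppling_count s *m Delta) s ->
    (forall i, 0 <= chi 0 i <= toppling_count s 0 i) -> chi != 0 ->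
  exists j, 1 <= chi 0 j /\ complement u 0 j < (chi *m Delta) 0 j.
Proof.
elim: s => [|i s IHs] /=.
  move=> _ chi0 /rV0Pn[j]; have := chi0 j; rewrite mxE /=; lia.
rewrite criticalE => /andP[ui].
have -> : topple Delta (u + toppling_count (i :: s) *m Delta) i =
    u + toppling_count s *m Delta.
  rewrite /topple toppling_count_cons mulmxDl -rowE.
  by rewrite [row i _ + _]addrC addrA addrK.
move=> /IHs{}IHs chis chi_neq0.
have [/forallP le_s|/forallPn[j chij]] :=
  boolP [forall k, chi 0 k <= toppling_count s 0 k].
  by apply: IHs => // k; rewrite le_s andbT; have /andP[] := chis k.
have chi_i : toppling_count (i :: s) 0 i = chi 0 i.
  have := chis j; move: chij; rewrite !mxE /=.
  case: eqVneq => [<-|]; rewrite ?eqxx; lia.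
exists i; split; first by rewrite -chi_i mxE /= eqxx.
(* [chi] equals the full count at [i] and is below it elsewhere, so its image at [i] is at least as
   large. *)
apply: lt_le_trans ui _; apply: zmatrix_mul_le => // k.
by have /andP[] := chis k.
Qed.

Lemma is_recurrentP r u : \det Delta != 0 -> rset Delta r ->
  is_recurrent Delta r u <-> superstable (complement u).
Proof.
move=> detD Rr; split=> [[[u0 stu] [s [ts us]]]|su].
  apply/(parking_rowP Rr) => [i|].
    by have := stu i; rewrite /critical mxE; lia.
  have cs : toppling_count s = r.
    have cs_r : (toppling_count s - r) *m Delta = 0.
      move: us; rewrite foldl_topple mulmxBl => /eqP.
      by rewrite -addrA -subr_eq0 addrAC subrr add0r -opprB oppr_eq0 => /eqP.
    apply/rowP => i; have := congr1 (mulmx^~ (\adj Delta)) cs_r.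
    rewrite -mulmxA mul_mx_adj mul0mx mul_mx_scalar => /rowP/(_ i)/eqP.
    by rewrite !mxE mulf_eq0 (negPf detD) subr_eq0 => /eqP.
  move=> chi [chi0r /rV0Pn chi_neq0].
  by apply: (toppling_parking_row (s := s)); rewrite ?cs.
split; first split=> i.
- by have := superstable_lt_diag i su; rewrite mxE; lia.
- by have := su.1 i; rewrite /critical mxE; lia.
apply: (@parking_row_toppling r); first exact/(parking_rowP Rr su.1).
by move=> i; rewrite lexx andbT ltW // Rr.1.
Qed.

Lemma exists_superstable r x : \det Delta != 0 -> rset Delta r ->
  exists v w, superstable v /\ v = x + w *m Delta.
Proof.
move=> detD [r0 rD0].
have [detD_gt0 nonsing] := zmatrix_nonsing_monotone zDelta r0 rD0 detD.
(* The negative part of [y] has a nonpositive image, so [nonsing] kills it. *)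
have monotone (y : 'rV_n) : (forall j, 0 <= (y *m Delta) 0 j) ->
    forall i, 0 <= y 0 i.
  move=> yD i; suff /pospart_eq0/(_ i) : pospart (- y) = 0.
    by rewrite mxE oppr_le0.
  apply: nonsing => [j|j]; first exact: pospart_ge0.
  have := @mul_pospart_le 0 (- y) _ _ j; rewrite [X in _ <= X]mxE; apply=> k.
    by rewrite mxE.
  by rewrite mulNmx mxE [X in _ <= X]mxE oppr_le0.
have adj_ge0 i j : 0 <= \adj Delta i j.
  suff : 0 <= row i (\adj Delta) 0 j by rewrite mxE.
  apply: monotone => k; rewrite -row_mul mul_adj_mx !mxE.
  by case: eqP => _ //; exact: ltW.
pose h := \adj Delta *m const_mx 1 : 'cV[int]_n.
have h_ge0 i : 0 <= h i 0.
  by rewrite mxE sumr_ge0 // => j _; rewrite [const_mx _ _ _]mxE mulr1.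
have mulh_ge0 v : (forall i, 0 <= v 0 i) -> 0 <= (v *m h) 0 0.
  by move=> v0; rewrite mxE sumr_ge0 // => j _; rewrite mulr_ge0.
have Dh chi : (chi *m Delta *m h) 0 0 = \det Delta * \sum_i chi 0 i.
  rewrite -mulmxA [Delta *m h]mulmxA mul_mx_adj mul_scalar_mx -scalemxAr !mxE.
  by congr (_ * _); apply: eq_bigr => i _; rewrite mxE mulr1.
have [v [w [v0 vx]]] : exists v w,
    (forall i, 0 <= v 0 i) /\ v = x + w *m Delta.
  (* The shift adds [k * \det Delta] to every coordinate, which is at least [k] and so outweighs any
     negative entry of [x]. *)
  pose k := \sum_i `|x 0 i|.
  exists (x + k *: (const_mx 1 *m \adj Delta) *m Delta).
  exists (k *: (const_mx 1 *m \adj Delta)); split=> // i.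
  rewrite -scalemxAl -mulmxA mul_adj_mx mul_mx_scalar !mxE mulr1.
  have xk : `|x 0 i| <= k by rewrite /k (bigD1 i) //= lerDl sumr_ge0.
  have k0 : 0 <= k by rewrite sumr_ge0.
  rewrite -lerBlDl sub0r (le_trans (ler_norm _)) // normrN.
  by rewrite (le_trans xk) // ler_peMr // -gtz0_ge1.
have [m] := ubnP `|((v *m h) 0 0)%R|%N.
elim: m v w v0 vx => // m IHm v w v0 vx vm.
have [[chi [chi0 chiv chi_neq0]]|nchi] := classic (exists chi,
    [/\ forall i, 0 <= chi 0 i, forall j, (chi *m Delta) 0 j <= v 0 j
      & chi != 0]); last first.
  exists v, w; split=> //; split=> // chi chi0 chiv.
  by have [//|chi_neq0] := eqVneq chi 0; case: nchi; exists chi.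
have v'0 i : 0 <= (v - chi *m Delta) 0 i.
  by rewrite mxE [X in _ + X]mxE subr_ge0.
apply: (IHm (v - chi *m Delta) (w - chi)) => //.
  by rewrite vx mulmxBl addrA.
rewrite -ltnS (leq_trans _ vm) // ltnS -ltz_nat !gez0_abs ?mulh_ge0 //.
rewrite mulmxBl mxE [X in _ + X]mxE gtrBl Dh mulr_gt0 // lt_def sumr_ge0 //.
rewrite andbT; apply: contra_neq chi_neq0 => /psumr_eq0P chi_eq0.
by apply/rowP => i; rewrite chi_eq0 ?mxE.
Qed.

End Superstable.

(* P and R are the common values, over all r in the set rset Delta, of the sets
   of parking functions and of recurrent configurations. *)
Theorem theorem3p8 (n : nat) (Delta : 'M[int]_n)
    (hn : (1 <= n)%N)
    (hdet : \det Delta != 0)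
    (hoff : forall i j : 'I_n, i != j -> Delta i j <= 0)
    (hr : exists r : 'rV[int]_n, rset Delta r) :
  exists (P : {fset {ffun 'I_n -> nat}}) (R : {fset 'rV[int]_n}),
    [/\ forall r : 'rV[int]_n, rset Delta r ->
          forall f : {ffun 'I_n -> nat}, f \in P <-> is_parking Delta r f,
        forall r : 'rV[int]_n, rset Delta r ->
          forall u : 'rV[int]_n, u \in R <-> is_recurrent Delta r u,
        #|` P|%fset = #|` R|%fset
      & (#|` R|%fset)%:Z = \det Delta].
Proof.
have [r0 Rr0] := hr.
have [detD _] := zmatrix_nonsing_monotone hoff Rr0.1 Rr0.2 hdet.
have [T [rep [cardT rep_surj rep_inj]]] := coset_transversal hdet.
have /fin_all_exists[F sF] t := exists_superstable hoff (rep t) hdet Rr0.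
have sF1 t : superstable Delta (F t) by have [w []] := sF t.
have F_inj : injective F.
  move=> t t' Ftt'; have [w [_ Ft]] := sF t; have [w' [_ Ft']] := sF t'.
  apply: (rep_inj _ _ (w' - w)); move: Ftt'; rewrite Ft Ft' mulmxBl.
  by move=> /(canRL (addrK _)) ->; rewrite addrA.
have F_surj v : superstable Delta v -> exists t, v = F t.
  move=> sv; have [t [w vE]] := rep_surj v; exists t.
  have [w' [_ Ft]] := sF t.
  apply: (superstable_coset_inj hoff (w := w - w') sv (sF1 t)).
  by rewrite vE Ft mulmxBl addrACA subrr addr0.
(* The absolute value loses nothing on the nonnegative rows [F t]. *)
pose toffun (v : 'rV[int]_n) := [ffun i => `|(v 0 i)%R|%N].
have toffunK t : \row_i (toffun (F t) i)%:Z = F t.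
  by apply/rowP => i; rewrite mxE ffunE gez0_abs // (sF1 t).1.
exists [fset toffun (F t) | t in T]%fset.
exists [fset complement Delta (F t) | t in T]%fset.
split.
- move=> r Rr f; rewrite (is_parkingP hoff _ Rr); split.
    by move=> /imfsetP[t _ ->]; rewrite toffunK.
  move=> /F_surj[t ft]; apply/imfsetP; exists t => //.
  by apply/ffunP => i; rewrite ffunE -ft mxE absz_nat.
- move=> r Rr u; rewrite (is_recurrentP hoff _ hdet Rr); split.
    by move=> /imfsetP[t _ ->]; rewrite complementK.
  move=> /F_surj[t ut]; apply/imfsetP; exists t => //.
  by rewrite -ut complementK.
- rewrite !card_imfset //.
    by move=> t t' /(inv_inj (complementK _))/F_inj.
  by move=> t t' /= tt'; apply: F_inj; rewrite -toffunK tt' toffunK.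
- rewrite card_imfset; last first.
    by move=> t t' /(inv_inj (complementK _))/F_inj.
  by rewrite /= -cardE cardT gtz0_abs.
Qed.
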